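(* Let $x_1\in X$, $y_1\in Y$, and let $j_1,j_2\ge1$ be integers. If $4\delta<\beta-\alpha$, then the map $\Sigma^{j_1,j_2}:Z\to Z$, $\Sigma^{j_1,j_2}(x,y)=(\Psi^{j_1}_{x_1}(y),\Phi^{j_2}_{y_1}(x))$, is a contraction mapping, with $$\mathrm{Lip}(\Sigma^{j_1,j_2})\le\frac{\kappa}{1-\kappa},\qquad \kappa=\max\left\{\frac{\delta}{\beta-\sigma},\frac{\delta}{\sigma-\alpha}\right\},$$ for $\sigma\in(\alpha+\delta,\beta-\delta)$.
   Context: Let $X,Y$ be Banach spaces and $Z=X\times Y$ with norm $\|(x,y)\|=\max\{\|x\|,\|y\|\}$; $P(x,y)=x$ and $Q(x,y)=y$ are the projections onto $X$ and $Y$. Let $A$ and $B$ be bounded linear operators on $X$ and $Y$, and $F:Z\to X$, $G:Z\to Y$. Assume there are $\alpha,\beta\in\mathbb{R}$ and $\delta\ge 0$ such that $\|e^{At}\|\le e^{\alpha t}$ and $\|e^{-Bt}\|\le e^{-\beta t}$ for all $t\ge0$; $H=(F,G)$ is Lipschitz with constant at most $\delta$ and $H(0)=0$; and $2\delta<\beta-\alpha$ (spectral gap condition). For $z_0\in Z$, $z(t,z_0)$, $t\in\mathbb{R}$, denotes the unique global solution of $\dot x=Ax+F(x,y)$, $\dot y=By+G(x,y)$ with $z(0,z_0)=z_0$. For $\sigma\in(\alpha+\delta,\beta-\delta)$ let $\mathcal{F}_\sigma=\{\varphi\in C([0,\infty),Z):\|\varphi\|_\sigma=\sup_{t\ge0}e^{-\sigma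 t}\|\varphi(t)\|<\infty\}$ and $\mathcal{G}_\sigma=\{\psi\in C((-\infty,0],Z):\|\psi\|_\sigma=\sup_{t\le0}e^{-\sigma t}\|\psi(t)\|<\infty\}$. For $z_0\in Z$, $x\in X$, $\varphi\in\mathcal{F}_\sigma$, $t\ge0$, let $\mathcal{T}_{z_0}(\varphi,x)(t)\in Z$ have $X$-component $e^{tA}x+\int_0^t e^{(t-s)A}[F(\varphi(s)+z(s,z_0))-F(z(s,z_0))]\,ds$ and $Y$-component $-\int_t^\infty e^{(t-s)B}[G(\varphi(s)+z(s,z_0))-G(z(s,z_0))]\,ds$. For $z_0\in Z$, $y\in Y$, $\psi\in\mathcal{G}_\sigma$, $t\le0$, let $\mathcal{U}_{z_0}(\psi,y)(t)\in Z$ have $X$-component $\int_{-\infty}^t e^{(t-s)A}[F(\psi(s)+z(s,z_0))-F(z(s,z_0))]\,ds$ and $Y$-component $e^{tB}y-\int_t^0 e^{(t-s)B}[G(\psi(s)+z(s,z_0))-G(z(s,z_0))]\,ds$. For $y_1\in Y$, use the base point $(0,y_1)$: $\varphi^0(x)(t)=(e^{\alpha t}x,0)$, $\varphi^j(x)=\mathcal{T}_{(0,y_1)}(\varphi^{j-1}(x),x)$ for $j\ge1$, and $\Phi^j_{y_1}(x)=y_1+Q\varphi^j(x)(0)$. For $x_1\in X$, use the base point $(x_1,0)$: $\psi^0(y)(t)=(0,e^{\beta t}y)$, $\psi^j(y)=\mathcal{U}_{(x_1,0)}(\psi^{j-1}(y),y)$ for $j\ge1$, and $\Psi^j_{x_1}(y)=x_1+P\psi^j(y)(0)$.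 These iterates do not depend on the choice of $\sigma$ in $(\alpha+\delta,\beta-\delta)$. *)

(* Defs.v *)
From Stdlib Require Import Reals Factorial.
From Coquelicot Require Import Coquelicot.
Open Scope R_scope.

(** Banach spaces are real: [CompleteNormedModule R_AbsRing]. *)

(** Coquelicot's canonical norm on [X * Y] is the Euclidean combination of the
    two norms, so the max norm is introduced separately; both induce the same
    topology. *)
Definition max_norm {X Y : NormedModule R_AbsRing} (z : X * Y) : R :=
  Rmax (norm (fst z)) (norm (snd z)).

Definition op_norm {X : NormedModule R_AbsRing} (L : X -> X) : Rbar :=
  Lub_Rbar (fun r => exists x : X, norm x <= 1 /\ r = norm (L x)).

(** Coquelicot's [is_Lipschitz] and [is_contraction] are stated with the balls
    of the uniform structure, which need not be the norm balls. *)
Definition lipschitz_with {X Y : NormedModule R_AbsRing}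
    (f : X * Y -> X * Y) (k : R) : Prop :=
  0 <= k /\
  forall z z' : X * Y,
    max_norm (minus (f z) (f z')) <= k * max_norm (minus z z').

Definition Lip {X Y : NormedModule R_AbsRing} (f : X * Y -> X * Y) : Rbar :=
  Glb_Rbar (lipschitz_with f).

Definition contraction {X Y : NormedModule R_AbsRing}
    (f : X * Y -> X * Y) : Prop :=
  exists k : R, k < 1 /\ lipschitz_with f k.

(** [op_exp A t x] is e^{tA} x, the sum of the series of t^n / n! A^n x. *)
Definition op_exp {X : CompleteNormedModule R_AbsRing}
    (A : X -> X) (t : R) (x : X) : X :=
  iota (is_series (fun n : nat => scal (t ^ n / INR (fact n)) (Nat.iter n A x))).

(** [z z0 t] is z(t, z_0). *)
Definition is_solution_flow {X Y : CompleteNormedModule R_AbsRing}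
    (A : X -> X) (B : Y -> Y) (F : X * Y -> X) (G : X * Y -> Y)
    (z : X * Y -> R -> X * Y) : Prop :=
  forall z0 : X * Y,
    z z0 0 = z0 /\
    forall t : R,
      is_derive (fun s => fst (z z0 s)) t (plus (A (fst (z z0 t))) (F (z z0 t))) /\
      is_derive (fun s => snd (z z0 s)) t (plus (B (snd (z z0 t))) (G (z z0 t))).

(** Elements of C([0,oo), Z) and C((-oo,0], Z) are represented by functions on
    the whole line.  [T_map] at t >= 0 only reads phi on [0,oo), and [U_map] at
    t <= 0 only reads psi on (-oo,0]; values elsewhere are meaningless. *)
Definition T_map {X Y : CompleteNormedModule R_AbsRing}
    (A : X -> X) (B : Y -> Y) (F : X * Y -> X) (G : X * Y -> Y)
    (z : X * Y -> R -> X * Y) (z0 : X * Y)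
    (phi : R -> X * Y) (x : X) (t : R) : X * Y :=
  (plus (op_exp A t x)
     (RInt (fun s => op_exp A (t - s)
              (minus (F (plus (phi s) (z z0 s))) (F (z z0 s)))) 0 t),
   opp (RInt_gen (fun s => op_exp B (t - s)
              (minus (G (plus (phi s) (z z0 s))) (G (z z0 s))))
          (at_point t) (Rbar_locally p_infty))).

Definition U_map {X Y : CompleteNormedModule R_AbsRing}
    (A : X -> X) (B : Y -> Y) (F : X * Y -> X) (G : X * Y -> Y)
    (z : X * Y -> R -> X * Y) (z0 : X * Y)
    (psi : R -> X * Y) (y : Y) (t : R) : X * Y :=
  (RInt_gen (fun s => op_exp A (t - s)
              (minus (F (plus (psi s) (z z0 s))) (F (z z0 s))))
     (Rbar_locally m_infty) (at_point t),
   minus (op_exp B t y)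
     (RInt (fun s => op_exp B (t - s)
              (minus (G (plus (psi s) (z z0 s))) (G (z z0 s)))) t 0)).

Fixpoint phi_iter {X Y : CompleteNormedModule R_AbsRing} (alpha : R)
    (A : X -> X) (B : Y -> Y) (F : X * Y -> X) (G : X * Y -> Y)
    (z : X * Y -> R -> X * Y) (y1 : Y) (j : nat) (x : X) : R -> X * Y :=
  match j with
  | O => fun t => (scal (exp (alpha * t)) x, zero)
  | S i => T_map A B F G z (zero, y1) (phi_iter alpha A B F G z y1 i x) x
  end.

Fixpoint psi_iter {X Y : CompleteNormedModule R_AbsRing} (beta : R)
    (A : X -> X) (B : Y -> Y) (F : X * Y -> X) (G : X * Y -> Y)
    (z : X * Y -> R -> X * Y) (x1 : X) (j : nat) (y : Y) : R -> X * Y :=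
  match j with
  | O => fun t => (zero, scal (exp (beta * t)) y)
  | S i => U_map A B F G z (x1, zero) (psi_iter beta A B F G z x1 i y) y
  end.

Definition Phi {X Y : CompleteNormedModule R_AbsRing} (alpha : R)
    (A : X -> X) (B : Y -> Y) (F : X * Y -> X) (G : X * Y -> Y)
    (z : X * Y -> R -> X * Y) (j : nat) (y1 : Y) (x : X) : Y :=
  plus y1 (snd (phi_iter alpha A B F G z y1 j x 0)).

Definition Psi {X Y : CompleteNormedModule R_AbsRing} (beta : R)
    (A : X -> X) (B : Y -> Y) (F : X * Y -> X) (G : X * Y -> Y)
    (z : X * Y -> R -> X * Y) (j : nat) (x1 : X) (y : Y) : X :=
  plus x1 (fst (psi_iter beta A B F G z x1 j y 0)).

Definition Sigma {X Y : CompleteNormedModule R_AbsRing} (alpha beta : R)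
    (A : X -> X) (B : Y -> Y) (F : X * Y -> X) (G : X * Y -> Y)
    (z : X * Y -> R -> X * Y) (j1 j2 : nat) (x1 : X) (y1 : Y)
    (w : X * Y) : X * Y :=
  (Psi beta A B F G z j1 x1 (snd w), Phi alpha A B F G z j2 y1 (fst w)).

(* Main.v *)
Require Import Defs.
From Stdlib Require Import Reals Lra Factorial.
From Coquelicot Require Import Coquelicot.
Open Scope R_scope.

(** Each component of [Sigma] is, up to a translation, the value at time 0 of an
    iterate of a Lyapunov-Perron map, and it reads only one of the two
    coordinates, so in the max norm it is enough to bound the Lipschitz constant of [Phi] and of [Psi]
    separately by kappa / (1 - kappa).

    For [Phi], measure a curve by the least D with |phi s| <= D e^{sigma s} for
    s >= 0.  Since alpha < sigma < beta, convolving against e^{tA} forwards and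
    against e^{tB} backwards multiplies this weighted size by at most
    1 / (sigma - alpha) and 1 / (beta - sigma), and the increments of F and G
    are delta-Lipschitz; so the map contracts the weighted size by kappa, and
    changing the initial value x costs |x - x'| in the first component only
    ([perron_map_diff]).  Starting from curves at distance at most |x - x'|, all the
    iterates stay at distance at most |x - x'| / (1 - kappa), because
    D = |x - x'| / (1 - kappa) solves |x - x'| + kappa D = D.  The second
    component does not see x directly, hence gains one more factor kappa
    ([perron_iter_lipschitz]).

    [Psi] is the same object run backwards in time: under t -> -t and the
    exchange of X and Y, the operators (A, B) become (-B, -A), the rates
    (alpha, beta) become (-beta, -alpha) and sigma becomes -sigma, which leaves
    kappa unchanged ([U_map_reverse]).  The estimates are therefore proved for an
    abstract pair of kernels E1, E2 in place of the two exponentials, from their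
    linearity, local Lipschitz continuity in t and exponential bounds, so that
    both directions of time are instances.

    The analytic substance is that all integrals exist.  Each iterate is shown
    to be continuous on the whole line and of exponential growth sigma
    ([perron_map_admissible]), so the integrands are continuous and the improper
    integrals converge absolutely.

    Finally sigma = (alpha + beta) / 2 makes kappa = 2 delta / (beta - alpha),
    which is below 1/2 when 4 delta < beta - alpha, so kappa / (1 - kappa) < 1. *)

(** * Algebra and limits in normed modules *)

Lemma minus_plus_l {G : AbelianGroup} (x y : G) : minus (plus x y) x = y.
Proof.
  refine (eq_trans (f_equal (fun v => plus v (opp x)) (plus_comm x y)) _).
  refine (eq_trans (eq_sym (plus_assoc y x (opp x))) _).
  exact (eq_trans (f_equal (plus y) (plus_opp_r x)) (plus_zero_r y)).
Qed.

Lemma minus_plus_minus {G : AbelianGroup} (a b c d : G) :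
  minus (plus a b) (plus c d) = plus (minus a c) (minus b d).
Proof.
  unfold minus. rewrite opp_plus, <- !plus_assoc. f_equal.
  rewrite !plus_assoc. f_equal. apply plus_comm.
Qed.

Lemma norm_minus_le {V : NormedModule R_AbsRing} (x y : V) :
  norm (minus x y) <= norm x + norm y.
Proof.
  eapply Rle_trans; [apply norm_triangle|]. rewrite norm_opp. apply Rle_refl.
Qed.

Lemma minus_plus_r {G : AbelianGroup} (a b c : G) : minus (plus a c) (plus b c) = minus a b.
Proof.
  refine (eq_trans (minus_plus_minus a c b c) _).
  refine (eq_trans (f_equal (plus _) (minus_eq_zero c)) (plus_zero_r _)).
Qed.

Lemma minus_opp_opp {G : AbelianGroup} (a b : G) :
  minus (opp a) (opp b) = opp (minus a b).
Proof. exact (eq_sym (opp_plus a (opp b))). Qed.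

Lemma norm_minus_sym {V : NormedModule R_AbsRing} (x y : V) :
  norm (minus x y) = norm (minus y x).
Proof. rewrite <- norm_opp, opp_minus; reflexivity. Qed.

Lemma exp_monotone (x y : R) : x <= y -> exp x <= exp y.
Proof.
  intros [hxy| ->]; [apply Rlt_le, exp_increasing, hxy|apply Rle_refl].
Qed.

(** The balls of the uniform structure need not be the norm balls, so
    epsilon-delta arguments with the norm go through this equivalence. *)
Lemma continuous_norm_iff {V : NormedModule R_AbsRing} (f : R -> V) (t : R) :
  continuous f t <->
  forall eps : R, 0 < eps -> exists d : R, 0 < d /\
    forall s : R, Rabs (s - t) < d -> norm (minus (f s) (f t)) < eps.
Proof.
  refine (iff_trans (filterlim_locally_ball_norm (F := locally t) f (f t)) _); split.
  - intros H eps heps.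
    destruct (H (mkposreal eps heps)) as [d Hd].
    exists d; split; [apply cond_pos|].
    intros s Hs; exact (Hd s Hs).
  - intros H eps.
    destruct (H eps (cond_pos eps)) as [d [hd Hd]].
    exists (mkposreal d hd); intros s Hs; exact (Hd s Hs).
Qed.

Lemma norm_limit_le {T : Type} {V : NormedModule R_AbsRing}
    (F : (T -> Prop) -> Prop) {FF : ProperFilter F} (f : T -> V) (l : V) (M : R) :
  filterlim f F (locally l) -> F (fun x => norm (f x) <= M) -> norm l <= M.
Proof.
  intros Hf HM.
  apply (filterlim_le (F := F) (fun x => norm (f x)) (fun _ => M) (norm l) M HM).
  - apply filterlim_comp with (1 := Hf). apply filterlim_norm.
  - apply filterlim_const.
Qed.

Lemma norm_series_le {V : NormedModule R_AbsRing} (a : nat -> V) (b : nat -> R)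
    (la : V) (lb : R) :
  (forall n, norm (a n) <= b n) -> is_series a la -> is_series b lb -> norm la <= lb.
Proof.
  intros Hab Ha Hb.
  apply (filterlim_le (F := eventually) (fun n => norm (sum_n a n)) (sum_n b) (norm la) lb).
  - exists O; intros n _.
    eapply Rle_trans; [apply norm_sum_n_m|].
    apply sum_n_m_le; exact Hab.
  - apply filterlim_comp with (1 := Ha). apply filterlim_norm.
  - exact Hb.
Qed.

(** * Exponentials of bounded operators *)

Lemma iter_linear_norm {X : NormedModule R_AbsRing} (A : X -> X) (M : R)
    (hM : 0 <= M) (hA : forall x, norm (A x) <= M * norm x) (n : nat) (x : X) :
  norm (Nat.iter n A x) <= M ^ n * norm x.
Proof.
  induction n as [|n IH]; simpl.
  - lra.
  - eapply Rle_trans; [apply hA|].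
    rewrite Rmult_assoc; apply Rmult_le_compat_l; assumption.
Qed.

Lemma exp_series (a c : R) :
  is_series (fun n => a ^ n / INR (fact n) * c) (exp a * c).
Proof.
  apply is_series_scal_r.
  apply is_series_ext with (2 := is_exp_Reals a).
  intros n. unfold scal; simpl; unfold mult; simpl.
  rewrite pow_n_pow; reflexivity.
Qed.

(** Crude but of the shape (1 + r)^n: it lets the series of e^{tA} - e^{sA} be
    dominated by an exponential series without shifting indices. *)
Lemma pow_diff_le (r s t : R) (n : nat) :
  Rabs t <= r -> Rabs s <= r -> Rabs (t ^ n - s ^ n) <= (1 + r) ^ n * Rabs (t - s).
Proof.
  intros ht hs.
  assert (hr : 0 <= r) by (pose proof (Rabs_pos t); lra).
  pose proof (Rabs_pos (t - s)) as hts.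
  induction n as [|n IH]; simpl.
  - rewrite Rminus_diag, Rabs_R0; lra.
  - replace (t * t ^ n - s * s ^ n) with (t * (t ^ n - s ^ n) + s ^ n * (t - s)) by ring.
    eapply Rle_trans; [apply Rabs_triang|]; rewrite !Rabs_mult.
    assert (Rabs (s ^ n) <= (1 + r) ^ n).
    { rewrite <- RPow_abs. apply pow_incr. split; [apply Rabs_pos|lra]. }
    assert (Rabs t * Rabs (t ^ n - s ^ n) <= r * ((1 + r) ^ n * Rabs (t - s))).
    { apply Rmult_le_compat; auto using Rabs_pos. }
    assert (Rabs (s ^ n) * Rabs (t - s) <= (1 + r) ^ n * Rabs (t - s)).
    { apply Rmult_le_compat_r; auto. }
    lra.
Qed.

Lemma op_exp_term_le {X : NormedModule R_AbsRing} (A : X -> X) (M : R)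
    (hM : 0 <= M) (hA : forall x, norm (A x) <= M * norm x) (c r d : R) (n : nat) (x : X) :
  Rabs c <= r ^ n * d ->
  norm (scal (c / INR (fact n)) (Nat.iter n A x))
    <= (r * M) ^ n / INR (fact n) * (d * norm x).
Proof.
  intros hc.
  eapply Rle_trans; [apply (@norm_scal R_AbsRing)|].
  change (abs (c / INR (fact n))) with (Rabs (c / INR (fact n))).
  pose proof (INR_fact_lt_0 n) as hf.
  pose proof (iter_linear_norm A M hM hA n x) as hi.
  unfold Rdiv; rewrite Rabs_mult, (Rabs_right (/ INR (fact n))).
  2: { apply Rle_ge, Rlt_le, Rinv_0_lt_compat, hf. }
  rewrite Rpow_mult_distr.
  replace (r ^ n * M ^ n * / INR (fact n) * (d * norm x))
    with ((r ^ n * d * / INR (fact n)) * (M ^ n * norm x)) by ring.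
  apply Rmult_le_compat; auto using norm_ge_0.
  - apply Rmult_le_pos; [apply Rabs_pos|]. apply Rlt_le, Rinv_0_lt_compat, hf.
  - apply Rmult_le_compat_r; auto. apply Rlt_le, Rinv_0_lt_compat, hf.
Qed.

(** The choice operator in [op_exp] is harmless because the exponential series
    is dominated by that of exp (|t| M), M being a bound for A. *)
Lemma op_exp_is_series {X : CompleteNormedModule R_AbsRing} (A : X -> X)
    (hA : is_linear A) (t : R) (x : X) :
  is_series (fun n => scal (t ^ n / INR (fact n)) (Nat.iter n A x)) (op_exp A t x).
Proof.
  destruct (linear_norm A hA) as [M [hM hAM]].
  unfold op_exp; apply iota_correct.
  destruct (ex_series_le (fun n => scal (t ^ n / INR (fact n)) (Nat.iter n A x))
    (fun n => (Rabs t * M) ^ n / INR (fact n) * (1 * norm x))) as [l Hl].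
  - intros n; apply (op_exp_term_le (X := X) A M); auto; [lra|].
    rewrite RPow_abs; lra.
  - eexists; apply exp_series.
  - exists l; split; [exact Hl|].
    intros l' Hl'; exact (filterlim_locally_unique _ _ _ Hl Hl').
Qed.

(** What the integral estimates use of t -> e^{tA}, in a form that is visibly
    stable under t -> -t. *)
Record regular_kernel {X : NormedModule R_AbsRing} (E : R -> X -> X) : Prop := {
  kernel_minus : forall t x y, E t (minus x y) = minus (E t x) (E t y);
  kernel_scal : forall t (k : R) x, E t (scal k x) = scal k (E t x);
  kernel_bound : forall r : R, exists K : R, 0 <= K /\
    forall s t x, Rabs s <= r -> Rabs t <= r ->
      norm (E t x) <= K * norm x /\
      norm (minus (E t x) (E s x)) <= K * Rabs (t - s) * norm x }.

(** Both local bounds come from termwise comparison with the series of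
    exp ((1 + r) M), M being a bound for A. *)
Lemma op_exp_regular {X : CompleteNormedModule R_AbsRing} (A : X -> X)
    (hA : is_linear A) : regular_kernel (op_exp A).
Proof.
  assert (iter_minus : forall n x y,
    Nat.iter n A (minus x y) = minus (Nat.iter n A x) (Nat.iter n A y)).
  { induction n as [|n IH]; intros x y; simpl; [reflexivity|].
    rewrite IH. unfold minus. rewrite (linear_plus A hA). f_equal.
    refine (eq_trans (f_equal A (eq_sym (scal_opp_one _))) _).
    refine (eq_trans (linear_scal A hA _ _) (scal_opp_one _)). }
  assert (iter_scal : forall n (k : R) x,
    Nat.iter n A (scal k x) = scal k (Nat.iter n A x)).
  { induction n as [|n IH]; intros k x; simpl; [reflexivity|].
    rewrite IH. apply (linear_scal A hA). }
  split.
  - intros t x y.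
    apply (filterlim_locally_unique _ _ _ (op_exp_is_series A hA t (minus x y))).
    eapply is_series_ext.
    2: { apply @is_series_minus; apply op_exp_is_series; exact hA. }
    intros n; simpl. rewrite iter_minus. exact (eq_sym (scal_minus_distr_l _ _ _)).
  - intros t k x.
    apply (filterlim_locally_unique _ _ _ (op_exp_is_series A hA t (scal k x))).
    eapply is_series_ext.
    2: { apply @is_series_scal_l; apply op_exp_is_series; exact hA. }
    intros n; simpl. rewrite iter_scal, !scal_assoc. f_equal.
    apply Rmult_comm.
  - intros r. destruct (linear_norm A hA) as [M [hM hAM]].
    exists (exp ((1 + r) * M)); split; [apply Rlt_le, exp_pos|].
    intros s t x hs ht. split.
    + replace (exp ((1 + r) * M) * norm x) with (exp ((1 + r) * M) * (1 * norm x)) by ring.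
      eapply norm_series_le; [|apply op_exp_is_series; exact hA | apply exp_series].
      intros n; simpl. apply (op_exp_term_le (X := X) A M); auto; [lra|].
      rewrite <- RPow_abs, Rmult_1_r. apply pow_incr. split; [apply Rabs_pos|lra].
    + rewrite Rmult_assoc.
      eapply norm_series_le.
      2: { apply @is_series_minus; apply op_exp_is_series; exact hA. }
      2: { apply exp_series. }
      intros n; simpl.
      assert (Hd : scal ((t ^ n - s ^ n) / INR (fact n)) (Nat.iter n A x)
        = minus (scal (t ^ n / INR (fact n)) (Nat.iter n A x))
                (scal (s ^ n / INR (fact n)) (Nat.iter n A x))).
      { refine (eq_trans _ (scal_minus_distr_r _ _ _)). f_equal.
        unfold minus, plus, opp; simpl; field. apply INR_fact_neq_0. }
      refine (Rle_trans _ _ _ (Req_le _ _ (f_equal norm (eq_sym Hd))) _).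
      apply (op_exp_term_le (X := X) A M); auto; [lra|]. apply pow_diff_le; assumption.
Qed.

(** [op_norm] is a supremum over the unit ball; homogeneity carries the bound to
    every vector. *)
Lemma op_norm_le_apply {X : NormedModule R_AbsRing} (L : X -> X) (c : R) :
  (forall (k : R) x, L (scal k x) = scal k (L x)) ->
  Rbar_le (op_norm L) (Finite c) -> forall x, norm (L x) <= c * norm x.
Proof.
  intros hL hc x.
  assert (h1 : forall y, norm y <= 1 -> norm (L y) <= c).
  { intros y hy.
    destruct (Lub_Rbar_correct (fun r => exists x : X, norm x <= 1 /\ r = norm (L x)))
      as [hub _].
    apply (Rbar_le_trans (norm (L y)) (op_norm L) c); [|exact hc].
    apply hub. exists y; split; auto. }
  destruct (Req_dec (norm x) 0) as [h0|h0].
  - assert (hz : L zero = zero)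
      by exact (eq_trans (f_equal L (eq_sym (scal_zero_l zero)))
                  (eq_trans (hL 0 zero) (scal_zero_l _))).
    rewrite h0, (norm_eq_zero x h0), hz, norm_zero; lra.
  - assert (hp : 0 < norm x) by (pose proof (norm_ge_0 x); lra).
    assert (hx : x = scal (norm x) (scal (/ norm x) x)).
    { refine (eq_sym (eq_trans (scal_assoc _ _ _) _)).
      refine (eq_trans (f_equal (fun k : R => scal k x) (Rinv_r _ h0)) (scal_one x)). }
    rewrite hx at 1. rewrite hL.
    eapply Rle_trans; [apply (@norm_scal R_AbsRing)|].
    change (Rabs (norm x) * norm (L (scal (/ norm x) x)) <= c * norm x).
    rewrite Rabs_right by lra. rewrite Rmult_comm.
    apply Rmult_le_compat_r; [lra|]. apply h1.
    eapply Rle_trans; [apply (@norm_scal R_AbsRing)|].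
    change (Rabs (/ norm x) * norm x <= 1).
    rewrite Rabs_right by (apply Rle_ge, Rlt_le, Rinv_0_lt_compat, hp).
    rewrite Rinv_l; lra.
Qed.

(** * Convolution integrals *)

Lemma norm_RInt_le_abs {V : NormedModule R_AbsRing} (f : R -> V) (a b : R)
    (l : V) (M : R) :
  (forall s, Rmin a b <= s <= Rmax a b -> norm (f s) <= M) ->
  is_RInt f a b l -> norm l <= Rabs (b - a) * M.
Proof.
  intros hf hl. destruct (Rle_dec a b) as [hab|hab].
  - rewrite Rmin_left, Rmax_right in hf by lra.
    rewrite Rabs_right by lra. exact (norm_RInt_le_const f a b l M hab hf hl).
  - rewrite Rmin_right, Rmax_left in hf by lra.
    rewrite Rabs_left by lra. rewrite <- norm_opp, Ropp_minus_distr.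
    apply (norm_RInt_le_const f b a); [lra|exact hf|].
    apply is_RInt_swap; exact hl.
Qed.

Lemma is_RInt_exp (c m n a b : R) : m <> 0 ->
  is_RInt (fun s => c * exp (m * s + n)) a b
    (c / m * (exp (m * b + n) - exp (m * a + n))).
Proof.
  intros hm.
  replace (c / m * (exp (m * b + n) - exp (m * a + n)))
    with (minus (c / m * exp (m * b + n)) (c / m * exp (m * a + n)))
    by (unfold minus, plus, opp; simpl; ring).
  apply (is_RInt_derive (fun s => c / m * exp (m * s + n))).
  - intros s _. auto_derive; [exact I|]. field; exact hm.
  - intros s _. apply (ex_derive_continuous (fun s => c * exp (m * s + n))).
    auto_derive; exact I.
Qed.

Lemma kernel_continuous {V : CompleteNormedModule R_AbsRing} (E : R -> V -> V)
    (hE : regular_kernel E) (h : R -> V) (hh : forall s, continuous h s) (t s : R) :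
  continuous (fun s => E (t - s) (h s)) s.
Proof.
  refine (proj2 (continuous_norm_iff (V := V) _ _) _); intros eps heps.
  destruct (kernel_bound E hE (Rabs (t - s) + 1)) as [K [hK HK]].
  set (m := norm (h s)). assert (hm : 0 <= m) by apply norm_ge_0.
  destruct (proj1 (continuous_norm_iff h s) (hh s) (eps / (2 * (K + 1)))) as [d [hd Hd]].
  { apply Rdiv_lt_0_compat; lra. }
  set (d' := eps / (2 * ((K + 1) * (m + 1)))).
  assert (hKm : 0 < (K + 1) * (m + 1)) by (apply Rmult_lt_0_compat; lra).
  assert (hd' : 0 < d') by (apply Rdiv_lt_0_compat; lra).
  exists (Rmin 1 (Rmin d d')); split.
  { repeat apply Rmin_glb_lt; lra. }
  intros s' hs'.
  assert (h1 : Rabs (s' - s) < 1) by (eapply Rlt_le_trans; [exact hs'|apply Rmin_l]).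
  assert (h2 : Rabs (s' - s) < Rmin d d') by (eapply Rlt_le_trans; [exact hs'|apply Rmin_r]).
  assert (h3 : Rabs (s' - s) < d) by (eapply Rlt_le_trans; [exact h2|apply Rmin_l]).
  assert (h4 : Rabs (s' - s) < d') by (eapply Rlt_le_trans; [exact h2|apply Rmin_r]).
  assert (hr : Rabs (t - s') <= Rabs (t - s) + 1).
  { replace (t - s') with ((t - s) + - (s' - s)) by ring.
    eapply Rle_trans; [apply Rabs_triang|]. rewrite Rabs_Ropp; lra. }
  rewrite (minus_trans (E (t - s') (h s))).
  eapply Rle_lt_trans; [apply @norm_triangle|].
  rewrite <- (kernel_minus E hE).
  destruct (HK (t - s) (t - s') (minus (h s') (h s))) as [b1 _]; [lra|lra|].
  destruct (HK (t - s) (t - s') (h s)) as [_ b2]; [lra|lra|].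
  fold m in b2.
  replace (t - s' - (t - s)) with (- (s' - s)) in b2 by ring.
  rewrite Rabs_Ropp in b2.
  specialize (Hd s' h3).
  assert (K * (eps / (2 * (K + 1))) < eps / 2).
  { replace (eps / 2) with ((K + 1) * (eps / (2 * (K + 1)))) by (field; lra).
    apply Rmult_lt_compat_r; [apply Rdiv_lt_0_compat; lra|lra]. }
  assert (K * Rabs (s' - s) * m <= d' * ((K + 1) * (m + 1))).
  { pose proof (Rabs_pos (s' - s)).
    replace (K * Rabs (s' - s) * m) with (Rabs (s' - s) * (K * m)) by ring.
    apply Rmult_le_compat; [lra|apply Rmult_le_pos; lra|lra|].
    apply Rmult_le_compat; lra. }
  replace (d' * ((K + 1) * (m + 1))) with (eps / 2) in * by (unfold d'; field; lra).
  apply Rle_lt_trans with (K * (eps / (2 * (K + 1))) + K * Rabs (s' - s) * m); [|lra].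
  apply Rplus_le_compat; [|exact b2].
  eapply Rle_trans; [exact b1|]. apply Rmult_le_compat_l; [exact hK|apply Rlt_le, Hd].
Qed.

Lemma kernel_ex_RInt {V : CompleteNormedModule R_AbsRing} (E : R -> V -> V)
    (hE : regular_kernel E) (h : R -> V) (hh : forall s, continuous h s) (t a b : R) :
  ex_RInt (fun s => E (t - s) (h s)) a b.
Proof. apply @ex_RInt_continuous; intros s _; apply kernel_continuous; assumption. Qed.

(** Moving t changes the integrand by O(|t' - t|) on a compact interval and adds
    an interval of length |t' - t| on which the integrand is bounded. *)
Lemma kernel_integral_continuous {V : CompleteNormedModule R_AbsRing} (E : R -> V -> V)
    (hE : regular_kernel E) (h : R -> V) (hh : forall s, continuous h s) (a t : R) :
  continuous (fun t => RInt (fun s => E (t - s) (h s)) a t) t.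
Proof.
  refine (proj2 (continuous_norm_iff (V := V) _ _) _); intros eps heps.
  (* All integration variables lie in [-m, m] as long as |t' - t| < 1. *)
  set (m := Rabs a + Rabs t + 1).
  assert (hm : 0 <= m) by (unfold m; pose proof (Rabs_pos a); pose proof (Rabs_pos t); lra).
  destruct (kernel_bound E hE (Rabs t + 1 + m)) as [K [hK HK]].
  destruct (bounded_continuity h (- m) m) as [H HH].
  { intros s _; apply hh. }
  assert (hH : 0 <= H).
  { pose proof (HH 0 ltac:(lra)). pose proof (norm_ge_0 (h 0)). lra. }
  set (c := K * H * (Rabs (t - a) + 1)).
  assert (hc : 0 <= c).
  { unfold c. pose proof (Rabs_pos (t - a)).
    apply Rmult_le_pos; [apply Rmult_le_pos; lra|lra]. }
  set (d := eps / (c + 1)).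
  assert (hd : 0 < d) by (apply Rdiv_lt_0_compat; lra).
  exists (Rmin 1 d); split; [apply Rmin_glb_lt; lra|].
  intros t' ht'.
  assert (h1 : Rabs (t' - t) < 1) by (eapply Rlt_le_trans; [exact ht'|apply Rmin_l]).
  assert (h2 : Rabs (t' - t) < d) by (eapply Rlt_le_trans; [exact ht'|apply Rmin_r]).
  set (f := fun t s => E (t - s) (h s)).
  assert (hf : forall t a b, ex_RInt (f t) a b)
    by (intros; apply kernel_ex_RInt; assumption).
  change (norm (minus (RInt (f t') a t') (RInt (f t) a t)) < eps).
  assert (hsplit : minus (RInt (f t') a t') (RInt (f t) a t)
    = plus (minus (RInt (f t') a t) (RInt (f t) a t)) (RInt (f t') t t')).
  { rewrite <- (RInt_Chasles (f t') a t t') by apply hf.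
    unfold minus. rewrite <- !plus_assoc. f_equal. apply plus_comm. }
  rewrite hsplit, <- RInt_minus by apply hf.
  eapply Rle_lt_trans; [apply @norm_triangle|].
  assert (hin : forall s, (Rmin a t <= s <= Rmax a t \/ Rmin t t' <= s <= Rmax t t') ->
     - m <= s <= m).
  { intros s hs. unfold m.
    revert hs h1. unfold Rmin, Rmax, Rabs.
    repeat destruct Rle_dec; repeat destruct Rcase_abs; lra. }
  assert (hdiff : forall u s, Rabs (u - t) < 1 -> - m <= s <= m -> Rabs (u - s) <= Rabs t + 1 + m).
  { intros u s hu hs. revert hu. unfold Rabs; repeat destruct Rcase_abs; lra. }
  assert (htt : Rabs (t - t) < 1) by (rewrite Rminus_diag, Rabs_R0; lra).
  assert (b1 : norm (RInt (fun s => minus (f t' s) (f t s)) a t)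
     <= Rabs (t - a) * (K * Rabs (t' - t) * H)).
  { apply (norm_RInt_le_abs (fun s => minus (f t' s) (f t s))).
    2: { apply RInt_correct, @ex_RInt_minus; apply hf. }
    intros s hs. specialize (hin s (or_introl hs)).
    destruct (HK (t - s) (t' - s) (h s)) as [_ b]; [apply hdiff; assumption..|].
    replace (t' - s - (t - s)) with (t' - t) in b by ring.
    eapply Rle_trans; [exact b|]. apply Rmult_le_compat_l.
    - apply Rmult_le_pos; [lra|apply Rabs_pos].
    - apply Rlt_le, HH, hin. }
  assert (b2 : norm (RInt (f t') t t') <= Rabs (t' - t) * (K * H)).
  { apply (norm_RInt_le_abs (f t')).
    2: { apply RInt_correct; apply hf. }
    intros s hs. specialize (hin s (or_intror hs)).
    destruct (HK (t - s) (t' - s) (h s)) as [b _]; [apply hdiff; assumption..|].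
    eapply Rle_trans; [exact b|]. apply Rmult_le_compat_l; [lra|].
    apply Rlt_le, HH, hin. }
  assert (Rabs (t' - t) * c <= d * c) by (apply Rmult_le_compat_r; lra).
  assert (hdc : d * (c + 1) = eps) by (unfold d; field; lra).
  replace (Rabs (t' - t) * c) with
    (Rabs (t - a) * (K * Rabs (t' - t) * H) + Rabs (t' - t) * (K * H)) in * by (unfold c; ring).
  refine (Rle_lt_trans _ _ _ (Rplus_le_compat _ _ _ _ b1 b2) _). lra.
Qed.

Lemma exp_decay (C gamma eps : R) : 0 <= C -> 0 < gamma -> 0 < eps ->
  exists B, forall s, B <= s -> C * exp (- gamma * s) < eps.
Proof.
  intros hC hg he. exists (C / (gamma * eps)). intros s hs.
  assert (h1 : C < eps * exp (gamma * s)).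
  { pose proof (exp_ineq1_le (gamma * s)).
    assert (C / (gamma * eps) * (gamma * eps) <= s * (gamma * eps)).
    { apply Rmult_le_compat_r; [|exact hs]. apply Rlt_le, Rmult_lt_0_compat; lra. }
    replace (C / (gamma * eps) * (gamma * eps)) with C in * by (field; lra).
    assert (eps * (1 + gamma * s) <= eps * exp (gamma * s))
      by (apply Rmult_le_compat_l; lra).
    lra. }
  replace (- gamma * s) with (- (gamma * s)) by ring. rewrite exp_Ropp.
  apply Rmult_lt_reg_r with (exp (gamma * s)); [apply exp_pos|].
  rewrite Rmult_assoc, Rinv_l; [lra|]. apply Rgt_not_eq, exp_pos.
Qed.

(** Continuity of the integrand makes every proper integral exist, so the
    relational limit in [is_RInt_gen] reduces to an ordinary one. *)
Lemma is_RInt_gen_halfline {V : CompleteNormedModule R_AbsRing} (k : R -> V) (t : R)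
    (hk : forall s, continuous k s) (l : V) :
  filterlim (fun b => RInt k t b) (Rbar_locally p_infty) (locally l) ->
  is_RInt_gen k (at_point t) (Rbar_locally p_infty) l.
Proof.
  intros H P HP. specialize (H P HP).
  apply (Filter_prod _ _ _ (fun a => a = t) (fun b => P (RInt k t b))).
  - reflexivity.
  - exact H.
  - intros a b -> hb. exists (RInt k t b); split; [|exact hb].
    apply RInt_correct, @ex_RInt_continuous; intros; apply hk.
Qed.

Lemma decaying_integral_le {V : CompleteNormedModule R_AbsRing} (k : R -> V)
    (M gamma T : R) (hg : 0 < gamma)
    (hk : forall s, continuous k s)
    (hdecay : forall s, T <= s -> norm (k s) <= M * exp (- gamma * s)) (a b : R) :
  T <= a <= b -> norm (RInt k a b) <= M / gamma * exp (- gamma * a).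
Proof.
  intros hab.
  assert (hM : 0 <= M).
  { pose proof (hdecay T (Rle_refl T)). pose proof (norm_ge_0 (k T)).
    pose proof (exp_pos (- gamma * T)). apply Rnot_lt_le; intros hn.
    assert (M * exp (- gamma * T) < 0) by (apply Rmult_neg_pos; lra). lra. }
  eapply Rle_trans.
  - refine (norm_RInt_le k (fun s => M * exp (- gamma * s + 0)) a b _ _ _ _ _ _).
    + lra.
    + intros s hs. rewrite Rplus_0_r. apply hdecay; lra.
    + apply RInt_correct, @ex_RInt_continuous; intros; apply hk.
    + apply is_RInt_exp; lra.
  - rewrite !Rplus_0_r.
    replace (M / - gamma * (exp (- gamma * b) - exp (- gamma * a)))
      with (M / gamma * exp (- gamma * a) - M / gamma * exp (- gamma * b)) by (field; lra).
    assert (0 <= M / gamma * exp (- gamma * b)).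
    { apply Rmult_le_pos; [apply Rdiv_le_0_compat; lra|apply Rlt_le, exp_pos]. }
    lra.
Qed.

(** The proper integrals are Cauchy because their tails are exponentially small.
    The decay may set in later than t: this covers negative t, where the growth
    of a curve is not controlled.  If T <= t, taking N = t yields the size of the
    integral itself. *)
Lemma decaying_improper_integral {V : CompleteNormedModule R_AbsRing} (k : R -> V)
    (M gamma T t : R) (hg : 0 < gamma)
    (hk : forall s, continuous k s)
    (hdecay : forall s, T <= s -> norm (k s) <= M * exp (- gamma * s)) :
  is_RInt_gen k (at_point t) (Rbar_locally p_infty)
    (RInt_gen k (at_point t) (Rbar_locally p_infty)) /\
  forall N, T <= N ->
    norm (minus (RInt_gen k (at_point t) (Rbar_locally p_infty)) (RInt k t N))
      <= M / gamma * exp (- gamma * N).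
Proof.
  assert (hex : forall a b, ex_RInt k a b)
    by (intros; apply @ex_RInt_continuous; intros; apply hk).
  assert (hint : forall N b, T <= N <= b ->
    norm (minus (RInt k t b) (RInt k t N)) <= M / gamma * exp (- gamma * N)).
  { intros N b hNb. rewrite <- (RInt_Chasles k t N b) by apply hex.
    refine (Rle_trans _ _ _ (Req_le _ _ (f_equal norm (minus_plus_l _ _))) _).
    apply (decaying_integral_le k M gamma T); assumption. }
  assert (hM : 0 <= M / gamma).
  { specialize (hint T T ltac:(lra)).
    pose proof (norm_ge_0 (minus (RInt k t T) (RInt k t T))).
    pose proof (exp_pos (- gamma * T)). apply Rnot_lt_le; intros hn.
    assert (M / gamma * exp (- gamma * T) < 0) by (apply Rmult_neg_pos; lra). lra. }
  assert (hlim : exists l, filterlim (fun b => RInt k t b) (Rbar_locally p_infty) (locally l)).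
  { apply (filterlim_locally_cauchy (U := V) (F := Rbar_locally p_infty)). intros eps.
    destruct (exp_decay (M / gamma) gamma eps hM hg (cond_pos eps)) as [B HB].
    set (B' := Rmax B T).
    assert (hB : B <= B') by apply Rmax_l. assert (hT : T <= B') by apply Rmax_r.
    exists (fun b => B' < b); split; [exists B'; auto|].
    intros u v hu hv. apply (norm_compat1 (V := V)).
    destruct (Rle_dec u v) as [huv|huv].
    - eapply Rle_lt_trans; [apply hint; lra|]. apply HB; lra.
    - rewrite norm_minus_sym.
      eapply Rle_lt_trans; [apply hint; lra|]. apply HB; lra. }
  destruct hlim as [l hl].
  assert (hgen := is_RInt_gen_halfline k t hk l hl).
  rewrite (is_RInt_gen_unique k l hgen). split; [exact hgen|].
  intros N hN.
  apply (norm_limit_le (Rbar_locally p_infty) (fun b => minus (RInt k t b) (RInt k t N))).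
  - exact (filterlim_comp_2 _ _ _ hl (filterlim_const (opp (RInt k t N)))
             (filterlim_plus (V := V) l (opp (RInt k t N)))).
  - exists N; intros b hb. apply hint; lra.
Qed.

(** The growth e^{sigma s} of h is beaten, for sigma < beta, by the decay
    e^{-beta s} of the kernel read backwards; the bound is uniform for t in bounded sets. *)
Lemma backward_kernel_decay {V : CompleteNormedModule R_AbsRing} (E : R -> V -> V)
    (beta sigma C : R)
    (hEb : forall t x, 0 <= t -> norm (E (- t) x) <= exp (- beta * t) * norm x)
    (h : R -> V) (hdecay : forall s, 0 <= s -> norm (h s) <= C * exp (sigma * s)) (t s : R) :
  Rmax t 0 <= s ->
  norm (E (t - s) (h s)) <= C * exp (beta * t) * exp (- (beta - sigma) * s).
Proof.
  intros hs. pose proof (Rmax_l t 0). pose proof (Rmax_r t 0).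
  replace (t - s) with (- (s - t)) by ring.
  eapply Rle_trans; [apply hEb; lra|].
  replace (C * exp (beta * t) * exp (- (beta - sigma) * s))
    with (exp (- beta * (s - t)) * (C * exp (sigma * s))).
  - apply Rmult_le_compat_l; [apply Rlt_le, exp_pos|]. apply hdecay; lra.
  - replace (exp (- beta * (s - t)) * (C * exp (sigma * s)))
      with (C * (exp (- beta * (s - t)) * exp (sigma * s))) by ring.
    rewrite Rmult_assoc, <- !exp_plus. f_equal. f_equal. ring.
Qed.

Lemma backward_integral_correct {V : CompleteNormedModule R_AbsRing} (E : R -> V -> V)
    (hE : regular_kernel E) (beta sigma C : R) (hgap : sigma < beta)
    (hEb : forall t x, 0 <= t -> norm (E (- t) x) <= exp (- beta * t) * norm x)
    (h : R -> V) (hh : forall s, continuous h s)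
    (hdecay : forall s, 0 <= s -> norm (h s) <= C * exp (sigma * s)) (t : R) :
  is_RInt_gen (fun s => E (t - s) (h s)) (at_point t) (Rbar_locally p_infty)
    (RInt_gen (fun s => E (t - s) (h s)) (at_point t) (Rbar_locally p_infty)).
Proof.
  apply (decaying_improper_integral (fun s => E (t - s) (h s)) (C * exp (beta * t)) (beta - sigma) (Rmax t 0)).
  - lra.
  - intros s; apply kernel_continuous; assumption.
  - intros s; apply backward_kernel_decay; assumption.
Qed.

Lemma backward_integral_norm_le {V : CompleteNormedModule R_AbsRing} (E : R -> V -> V)
    (hE : regular_kernel E) (beta sigma C : R) (hgap : sigma < beta)
    (hEb : forall t x, 0 <= t -> norm (E (- t) x) <= exp (- beta * t) * norm x)
    (h : R -> V) (hh : forall s, continuous h s)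
    (hdecay : forall s, 0 <= s -> norm (h s) <= C * exp (sigma * s)) (t : R) :
  0 <= t ->
  norm (RInt_gen (fun s => E (t - s) (h s)) (at_point t) (Rbar_locally p_infty))
    <= C / (beta - sigma) * exp (sigma * t).
Proof.
  intros ht.
  destruct (decaying_improper_integral (fun s => E (t - s) (h s)) (C * exp (beta * t)) (beta - sigma) (Rmax t 0) t)
    as [_ hrem].
  - lra.
  - intros s; apply kernel_continuous; assumption.
  - intros s; apply backward_kernel_decay; assumption.
  - specialize (hrem t ltac:(rewrite Rmax_left; lra)).
    rewrite RInt_point in hrem.
    refine (Rle_trans _ _ _ (Req_le _ _ (f_equal norm (eq_sym (minus_zero_r _)))) _).
    eapply Rle_trans; [exact hrem|]. apply Req_le.
    replace (C * exp (beta * t) / (beta - sigma) * exp (- (beta - sigma) * t))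
      with (C / (beta - sigma) * (exp (beta * t) * exp (- (beta - sigma) * t)))
      by (field; lra).
    rewrite <- exp_plus. f_equal. f_equal. ring.
Qed.

(** Uniform limit argument: up to a tail that is small uniformly for t near the
    given point, the integral runs to a fixed N, where
    [kernel_integral_continuous] applies. *)
Lemma backward_integral_continuous {V : CompleteNormedModule R_AbsRing} (E : R -> V -> V)
    (hE : regular_kernel E) (beta sigma C : R) (hgap : sigma < beta)
    (hEb : forall t x, 0 <= t -> norm (E (- t) x) <= exp (- beta * t) * norm x)
    (h : R -> V) (hh : forall s, continuous h s)
    (hdecay : forall s, 0 <= s -> norm (h s) <= C * exp (sigma * s)) (t : R) :
  continuous (fun t => RInt_gen (fun s => E (t - s) (h s)) (at_point t) (Rbar_locally p_infty)) t.
Proof.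
  refine (proj2 (continuous_norm_iff (V := V) _ _) _); intros eps heps.
  assert (hC : 0 <= C).
  { specialize (hdecay 0 (Rle_refl 0)). rewrite Rmult_0_r, exp_0 in hdecay.
    pose proof (norm_ge_0 (h 0)); lra. }
  (* The constant bounds C e^{beta u} / (beta - sigma) whenever |u - t| < 1. *)
  set (D := C * exp (beta * t + Rabs beta) / (beta - sigma)).
  assert (hD : 0 <= D).
  { apply Rdiv_le_0_compat; [|lra]. apply Rmult_le_pos; [lra|apply Rlt_le, exp_pos]. }
  destruct (exp_decay D (beta - sigma) (eps / 3)) as [B HB]; [lra..|].
  set (N := Rmax B (Rmax (t + 1) 0)).
  assert (hNB : B <= N) by apply Rmax_l.
  assert (hNt : Rmax (t + 1) 0 <= N) by apply Rmax_r.
  pose proof (Rmax_l (t + 1) 0). pose proof (Rmax_r (t + 1) 0).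
  specialize (HB N hNB).
  destruct (proj1 (continuous_norm_iff _ _) (kernel_integral_continuous E hE h hh N t) (eps / 3))
    as [d [hd Hd]]; [lra|].
  exists (Rmin 1 d); split; [apply Rmin_glb_lt; lra|].
  intros t' ht'.
  assert (h1 : Rabs (t' - t) < 1) by (eapply Rlt_le_trans; [exact ht'|apply Rmin_l]).
  specialize (Hd t' ltac:(eapply Rlt_le_trans; [exact ht'|apply Rmin_r])).
  set (J := fun t => RInt_gen (fun s => E (t - s) (h s)) (at_point t) (Rbar_locally p_infty)).
  set (I := fun t => RInt (fun s => E (t - s) (h s)) N t) in *.
  assert (hrem : forall u, Rabs (u - t) < 1 -> norm (plus (J u) (I u)) < eps / 3).
  { intros u hu.
    assert (hut : t - 1 < u < t + 1) by (revert hu; unfold Rabs; destruct Rcase_abs; lra).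
    assert (hmax : Rmax u 0 <= N) by (apply Rmax_lub; lra).
    destruct (decaying_improper_integral (fun s => E (u - s) (h s)) (C * exp (beta * u)) (beta - sigma) (Rmax u 0) u)
      as [_ hr].
    - lra.
    - intros s; apply kernel_continuous; assumption.
    - intros s; apply backward_kernel_decay; assumption.
    - specialize (hr N hmax). unfold minus in hr.
      rewrite opp_RInt_swap in hr.
      2: { apply ex_RInt_swap, kernel_ex_RInt; assumption. }
      eapply Rle_lt_trans; [exact hr|]. eapply Rle_lt_trans; [|exact HB].
      apply Rmult_le_compat_r; [apply Rlt_le, exp_pos|].
      unfold D, Rdiv. apply Rmult_le_compat_r; [apply Rlt_le, Rinv_0_lt_compat; lra|].
      apply Rmult_le_compat_l; [exact hC|].
      apply exp_monotone. replace (beta * u) with (beta * t + beta * (u - t)) by ring.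
      apply Rplus_le_compat_l. eapply Rle_trans; [apply Rle_abs|].
      rewrite Rabs_mult. pose proof (Rabs_pos beta).
      rewrite <- (Rmult_1_r (Rabs beta)) at 2. apply Rmult_le_compat_l; lra. }
  assert (hr := hrem t ltac:(rewrite Rminus_diag, Rabs_R0; lra)).
  assert (hr' := hrem t' h1).
  change (norm (minus (J t') (J t)) < eps).
  (* The integral over [t,N] cancels between [J] and [I], which leaves two tails. *)
  assert (hsplit : minus (J t') (J t)
    = minus (minus (plus (J t') (I t')) (plus (J t) (I t))) (minus (I t') (I t))).
  { symmetry. refine (eq_trans (f_equal (fun v => minus v _) (minus_plus_minus _ _ _ _)) _).
    refine (eq_trans (f_equal (fun v => minus v _) (plus_comm _ _)) _).
    apply minus_plus_l. }
  rewrite hsplit.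
  refine (Rle_lt_trans _ _ _ (norm_minus_le _ _) _).
  pose proof (norm_minus_le (plus (J t') (I t')) (plus (J t) (I t))).
  apply Rlt_le_trans with (eps / 3 + eps / 3 + eps / 3); [|lra].
  apply Rplus_lt_compat; [|exact Hd].
  refine (Rle_lt_trans _ _ _ (norm_minus_le _ _) _).
  apply Rplus_lt_compat; assumption.
Qed.

Lemma forward_integral_norm_le {V : CompleteNormedModule R_AbsRing} (E : R -> V -> V)
    (hE : regular_kernel E) (alpha sigma C : R) (hgap : alpha < sigma)
    (hEa : forall t x, 0 <= t -> norm (E t x) <= exp (alpha * t) * norm x)
    (h : R -> V) (hh : forall s, continuous h s)
    (hdecay : forall s, 0 <= s -> norm (h s) <= C * exp (sigma * s)) (t : R) :
  0 <= t ->
  norm (RInt (fun s => E (t - s) (h s)) 0 t)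
    <= C / (sigma - alpha) * (exp (sigma * t) - exp (alpha * t)).
Proof.
  intros ht.
  replace (C / (sigma - alpha) * (exp (sigma * t) - exp (alpha * t)))
    with (C / (sigma - alpha) *
       (exp ((sigma - alpha) * t + alpha * t) - exp ((sigma - alpha) * 0 + alpha * t))).
  2: { replace ((sigma - alpha) * t + alpha * t) with (sigma * t) by ring.
       replace ((sigma - alpha) * 0 + alpha * t) with (alpha * t) by ring. reflexivity. }
  refine (norm_RInt_le (fun s => E (t - s) (h s))
    (fun s => C * exp ((sigma - alpha) * s + alpha * t)) 0 t _ _ ht _ _ _).
  - intros s hs. eapply Rle_trans; [apply hEa; lra|].
    replace ((sigma - alpha) * s + alpha * t) with (alpha * (t - s) + sigma * s) by ring.
    rewrite exp_plus.
    replace (C * (exp (alpha * (t - s)) * exp (sigma * s)))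
      with (exp (alpha * (t - s)) * (C * exp (sigma * s))) by ring.
    apply Rmult_le_compat_l; [apply Rlt_le, exp_pos|]. apply hdecay; lra.
  - apply RInt_correct, kernel_ex_RInt; assumption.
  - apply is_RInt_exp; lra.
Qed.

(** * The Lyapunov-Perron map *)

Lemma max_norm_le {U V : NormedModule R_AbsRing} (w : U * V) (c : R) :
  norm (fst w) <= c -> norm (snd w) <= c -> max_norm w <= c.
Proof. intros; apply Rmax_lub; assumption. Qed.

Lemma max_norm_swap {U V : NormedModule R_AbsRing} (w : U * V) :
  max_norm (snd w, fst w) = max_norm w.
Proof. apply Rmax_comm. Qed.

(** Componentwise, which avoids comparing the Euclidean norm of the product with
    the max norm. *)
Definition pair_continuous {U V : NormedModule R_AbsRing} (phi : R -> U * V) : Prop :=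
  (forall t, continuous (fun s => fst (phi s)) t) /\
  (forall t, continuous (fun s => snd (phi s)) t).

(** Models w -> F (w + z(s)) - F (z(s)); continuity is asked along curves, the
    form in which N occurs in the integrands. *)
Record perturbation {U V W : NormedModule R_AbsRing} (delta : R)
    (N : R -> U * V -> W) : Prop := {
  perturbation_lipschitz : forall s w w',
    norm (minus (N s w) (N s w')) <= delta * max_norm (minus w w');
  perturbation_zero : forall s, N s zero = zero;
  perturbation_continuous : forall phi, pair_continuous phi ->
    forall t, continuous (fun s => N s (phi s)) t }.

Record dichotomy {U V : CompleteNormedModule R_AbsRing} (alpha beta : R)
    (E1 : R -> U -> U) (E2 : R -> V -> V) : Prop := {
  forward_regular : regular_kernel E1;
  backward_regular : regular_kernel E2;
  forward_bound : forall t x, 0 <= t -> norm (E1 t x) <= exp (alpha * t) * norm x;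
  backward_bound : forall t x, 0 <= t -> norm (E2 (- t) x) <= exp (- beta * t) * norm x }.

Definition perron_map {U V : CompleteNormedModule R_AbsRing}
    (E1 : R -> U -> U) (E2 : R -> V -> V) (N1 : R -> U * V -> U) (N2 : R -> U * V -> V)
    (phi : R -> U * V) (x : U) (t : R) : U * V :=
  (plus (E1 t x) (RInt (fun s => E1 (t - s) (N1 s (phi s))) 0 t),
   opp (RInt_gen (fun s => E2 (t - s) (N2 s (phi s)))
          (at_point t) (Rbar_locally p_infty))).

Fixpoint perron_iter {U V : CompleteNormedModule R_AbsRing} (alpha : R)
    (E1 : R -> U -> U) (E2 : R -> V -> V) (N1 : R -> U * V -> U) (N2 : R -> U * V -> V)
    (j : nat) (x : U) : R -> U * V :=
  match j with
  | O => fun t => (scal (exp (alpha * t)) x, zero)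
  | S i => perron_map E1 E2 N1 N2 (perron_iter alpha E1 E2 N1 N2 i x) x
  end.

(** Continuity is asked on the whole line although growth is measured on [0, oo)
    only: the formulas for the iterates stay meaningful for negative times, and so
    the integrands are continuous across 0. *)
Definition admissible {U V : NormedModule R_AbsRing} (sigma : R) (phi : R -> U * V) : Prop :=
  pair_continuous phi /\
  exists C, forall s, 0 <= s -> max_norm (phi s) <= C * exp (sigma * s).

Lemma perturbation_norm_le {U V W : NormedModule R_AbsRing} (delta : R)
    (N : R -> U * V -> W) (hN : perturbation delta N) (s : R) (w : U * V) :
  norm (N s w) <= delta * max_norm w.
Proof.
  pose proof (perturbation_lipschitz delta N hN s w zero) as h.
  rewrite (perturbation_zero delta N hN) in h.
  refine (Rle_trans _ _ _ (Req_le _ _ (f_equal norm (eq_sym (minus_zero_r _)))) _).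
  refine (Rle_trans _ _ _ h (Req_le _ _ (f_equal (fun w => delta * max_norm w) _))).
  apply (minus_zero_r (G := prod_AbelianGroup U V)).
Qed.

Lemma perturbation_decay {U V W : NormedModule R_AbsRing} (delta sigma C : R)
    (hdelta : 0 <= delta)
    (N : R -> U * V -> W) (hN : perturbation delta N) (phi : R -> U * V)
    (hphi : forall s, 0 <= s -> max_norm (phi s) <= C * exp (sigma * s)) (s : R) :
  0 <= s -> norm (N s (phi s)) <= delta * C * exp (sigma * s).
Proof.
  intros hs. eapply Rle_trans; [apply perturbation_norm_le; exact hN|].
  rewrite Rmult_assoc. apply Rmult_le_compat_l; auto.
Qed.

Lemma regular_kernel_continuous {V : CompleteNormedModule R_AbsRing} (E : R -> V -> V)
    (hE : regular_kernel E) (x : V) (t : R) : continuous (fun t => E t x) t.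
Proof.
  apply (continuous_ext (fun t => E (0 - - t) x)).
  { intros s; simpl. f_equal. ring. }
  apply (continuous_comp (fun t : R => - t) (fun s => E (0 - s) x)).
  - apply (continuous_opp (fun t : R => t)). apply continuous_id.
  - apply (kernel_continuous E hE (fun _ => x)). intros; apply continuous_const.
Qed.

Section Perron.
Context {U V : CompleteNormedModule R_AbsRing} (alpha beta delta sigma : R)
  (E1 : R -> U -> U) (E2 : R -> V -> V) (N1 : R -> U * V -> U) (N2 : R -> U * V -> V)
  (hdelta : 0 <= delta) (hsigma : alpha < sigma < beta)
  (hE : dichotomy alpha beta E1 E2) (hN1 : perturbation delta N1) (hN2 : perturbation delta N2).

(** This keeps the iteration inside the class of curves for which the integrals
    of the next step exist. *)
Lemma perron_map_admissible (phi : R -> U * V) (x : U) :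
  admissible sigma phi -> admissible sigma (perron_map E1 E2 N1 N2 phi x).
Proof.
  destruct hE as [hE1 hE2 ha hb].
  intros [hc [C hC]].
  pose proof (perturbation_continuous _ _ hN1 phi hc) as hc1.
  pose proof (perturbation_continuous _ _ hN2 phi hc) as hc2.
  pose proof (perturbation_decay delta sigma C hdelta N1 hN1 phi hC) as hd1.
  pose proof (perturbation_decay delta sigma C hdelta N2 hN2 phi hC) as hd2.
  split; [split|].
  - intros t. apply (continuous_plus (fun t => E1 t x)).
    + apply regular_kernel_continuous; exact hE1.
    + apply (kernel_integral_continuous E1 hE1 (fun s => N1 s (phi s)) hc1).
  - intros t.
    apply (continuous_opp
      (fun t => RInt_gen (fun s => E2 (t - s) (N2 s (phi s))) (at_point t) (Rbar_locally p_infty))).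
    apply (backward_integral_continuous E2 hE2 beta sigma (delta * C)
             ltac:(lra) hb (fun s => N2 s (phi s)) hc2 hd2).
  - assert (hC0 : 0 <= delta * C).
    { specialize (hd1 0 (Rle_refl 0)). rewrite Rmult_0_r, exp_0 in hd1.
      pose proof (norm_ge_0 (N1 0 (phi 0))); lra. }
    exists (norm x + delta * C / (sigma - alpha) + delta * C / (beta - sigma)).
    intros t ht.
    assert (q1 : 0 <= delta * C / (sigma - alpha)) by (apply Rdiv_le_0_compat; lra).
    assert (q2 : 0 <= delta * C / (beta - sigma)) by (apply Rdiv_le_0_compat; lra).
    pose proof (norm_ge_0 x) as hx.
    pose proof (exp_pos (sigma * t)) as hp.
    apply max_norm_le; simpl.
    + eapply Rle_trans; [apply @norm_triangle|].
      pose proof (ha t x ht) as b1.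
      pose proof (forward_integral_norm_le E1 hE1 alpha sigma (delta * C) ltac:(lra) ha
                    (fun s => N1 s (phi s)) hc1 hd1 t ht) as b2.
      refine (Rle_trans _ _ _ (Rplus_le_compat _ _ _ _ b1 b2) _).
      assert (exp (alpha * t) <= exp (sigma * t))
        by (apply exp_monotone, Rmult_le_compat_r; lra).
      assert (exp (alpha * t) * norm x <= exp (sigma * t) * norm x)
        by (apply Rmult_le_compat_r; assumption).
      assert (0 <= delta * C / (sigma - alpha) * exp (alpha * t))
        by (apply Rmult_le_pos; [assumption|apply Rlt_le, exp_pos]).
      assert (0 <= delta * C / (beta - sigma) * exp (sigma * t))
        by (apply Rmult_le_pos; lra).
      lra.
    + refine (Rle_trans _ _ _ (Req_le _ _ (norm_opp _)) _).
      refine (Rle_trans _ _ _ (backward_integral_norm_le E2 hE2 beta sigma (delta * C)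
             ltac:(lra) hb (fun s => N2 s (phi s)) hc2 hd2 t ht) _).
      apply Rmult_le_compat_r; lra.
Qed.

Lemma perron_iter_admissible (j : nat) (x : U) :
  admissible sigma (perron_iter alpha E1 E2 N1 N2 j x).
Proof.
  induction j as [|j IH]; simpl; [|apply perron_map_admissible, IH].
  split; [split|]; simpl.
  - intros t. apply (continuous_scal_l (fun t => exp (alpha * t)) x).
    apply (ex_derive_continuous (fun t => exp (alpha * t))). auto_derive; exact I.
  - intros t; apply continuous_const.
  - exists (norm x). intros s hs. pose proof (norm_ge_0 x) as hx.
    assert (hexp : exp (alpha * s) <= exp (sigma * s))
      by (apply exp_monotone, Rmult_le_compat_r; lra).
    apply max_norm_le; simpl.
    + eapply Rle_trans; [apply (@norm_scal R_AbsRing)|].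
      change (Rabs (exp (alpha * s)) * norm x <= norm x * exp (sigma * s)).
      rewrite Rabs_right by (apply Rle_ge, Rlt_le, exp_pos).
      rewrite Rmult_comm. apply Rmult_le_compat_l; assumption.
    + refine (Rle_trans _ _ _ (Req_le _ _ norm_zero) _). apply Rmult_le_pos; [assumption|apply Rlt_le, exp_pos].
Qed.

(** The weight e^{sigma t} dominates the growth e^{alpha t} of the initial value,
    which enters the first component only. *)
Lemma perron_map_diff (phi phi' : R -> U * V) (x x' : U) (D : R) :
  admissible sigma phi -> admissible sigma phi' ->
  (forall s, 0 <= s -> max_norm (minus (phi s) (phi' s)) <= D * exp (sigma * s)) ->
  forall t, 0 <= t ->
  norm (minus (fst (perron_map E1 E2 N1 N2 phi x t)) (fst (perron_map E1 E2 N1 N2 phi' x' t)))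
    <= (norm (minus x x') + delta * D / (sigma - alpha)) * exp (sigma * t) /\
  norm (minus (snd (perron_map E1 E2 N1 N2 phi x t)) (snd (perron_map E1 E2 N1 N2 phi' x' t)))
    <= delta * D / (beta - sigma) * exp (sigma * t).
Proof.
  destruct hE as [hE1 hE2 ha hb].
  intros [hc [C hC]] [hc' [C' hC']] hD t ht.
  pose proof (perturbation_continuous _ _ hN1 phi hc) as hc1.
  pose proof (perturbation_continuous _ _ hN2 phi hc) as hc2.
  pose proof (perturbation_continuous _ _ hN1 phi' hc') as hc1'.
  pose proof (perturbation_continuous _ _ hN2 phi' hc') as hc2'.
  pose proof (perturbation_decay delta sigma C hdelta N2 hN2 phi hC) as hd2.
  pose proof (perturbation_decay delta sigma C' hdelta N2 hN2 phi' hC') as hd2'.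
  set (h1 := fun s => minus (N1 s (phi s)) (N1 s (phi' s))).
  set (h2 := fun s => minus (N2 s (phi s)) (N2 s (phi' s))).
  assert (hh1 : forall s, continuous h1 s)
    by (intros s; apply (continuous_minus (V := U)); [apply hc1|apply hc1']).
  assert (hh2 : forall s, continuous h2 s)
    by (intros s; apply (continuous_minus (V := V)); [apply hc2|apply hc2']).
  assert (he1 : forall s, 0 <= s -> norm (h1 s) <= delta * D * exp (sigma * s)).
  { intros s hs. eapply Rle_trans; [apply (perturbation_lipschitz _ _ hN1)|].
    rewrite Rmult_assoc. apply Rmult_le_compat_l; auto. }
  assert (he2 : forall s, 0 <= s -> norm (h2 s) <= delta * D * exp (sigma * s)).
  { intros s hs. eapply Rle_trans; [apply (perturbation_lipschitz _ _ hN2)|].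
    rewrite Rmult_assoc. apply Rmult_le_compat_l; auto. }
  split; simpl.
  - refine (Rle_trans _ _ _ (Req_le _ _ (f_equal norm (minus_plus_minus _ _ _ _))) _).
    eapply Rle_trans; [apply @norm_triangle|].
    assert (b1 : norm (minus (E1 t x) (E1 t x')) <= exp (alpha * t) * norm (minus x x')).
    { refine (Rle_trans _ _ _ (Req_le _ _ (f_equal norm (eq_sym (kernel_minus E1 hE1 t x x')))) _).
      apply ha; exact ht. }
    pose proof (forward_integral_norm_le E1 hE1 alpha sigma (delta * D) ltac:(lra) ha
                  h1 hh1 he1 t ht) as b2.
    assert (hI : RInt (fun s => E1 (t - s) (h1 s)) 0 t
      = minus (RInt (fun s => E1 (t - s) (N1 s (phi s))) 0 t)
              (RInt (fun s => E1 (t - s) (N1 s (phi' s))) 0 t)).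
    { rewrite <- RInt_minus.
      - apply RInt_ext; intros s _. apply (kernel_minus E1 hE1).
      - apply (kernel_ex_RInt E1 hE1 (fun s => N1 s (phi s)) hc1).
      - apply (kernel_ex_RInt E1 hE1 (fun s => N1 s (phi' s)) hc1'). }
    rewrite hI in b2.
    refine (Rle_trans _ _ _ (Rplus_le_compat _ _ _ _ b1 b2) _).
    assert (hD0 : 0 <= delta * D).
    { specialize (he1 0 (Rle_refl 0)). rewrite Rmult_0_r, exp_0 in he1.
      pose proof (norm_ge_0 (h1 0)); lra. }
    assert (exp (alpha * t) * norm (minus x x') <= exp (sigma * t) * norm (minus x x')).
    { apply Rmult_le_compat_r; [apply norm_ge_0|].
      apply exp_monotone, Rmult_le_compat_r; lra. }
    assert (0 <= delta * D / (sigma - alpha) * exp (alpha * t)).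
    { apply Rmult_le_pos; [apply Rdiv_le_0_compat; lra|apply Rlt_le, exp_pos]. }
    lra.
  - pose proof (backward_integral_norm_le E2 hE2 beta sigma (delta * D) ltac:(lra) hb
                  h2 hh2 he2 t ht) as b.
    pose proof (backward_integral_correct E2 hE2 beta sigma (delta * C) ltac:(lra) hb
                  (fun s => N2 s (phi s)) hc2 hd2 t) as i.
    pose proof (backward_integral_correct E2 hE2 beta sigma (delta * C') ltac:(lra) hb
                  (fun s => N2 s (phi' s)) hc2' hd2' t) as i'.
    set (J := RInt_gen (fun s => E2 (t - s) (N2 s (phi s))) (at_point t) (Rbar_locally p_infty)) in *.
    set (J' := RInt_gen (fun s => E2 (t - s) (N2 s (phi' s))) (at_point t) (Rbar_locally p_infty)) in *.
    assert (hJ : RInt_gen (fun s => E2 (t - s) (h2 s)) (at_point t) (Rbar_locally p_infty)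
      = minus J J').
    { apply is_RInt_gen_unique.
      eapply is_RInt_gen_ext; [|exact (is_RInt_gen_minus _ _ _ _ i i')].
      apply filter_forall. intros ab s _. symmetry. apply (kernel_minus E2 hE2). }
    rewrite hJ in b.
    refine (Rle_trans _ _ _ _ b). apply Req_le.
    refine (eq_trans (eq_sym (norm_opp _)) (f_equal norm _)).
    refine (eq_trans (opp_minus _ _) _). unfold minus at 1. rewrite opp_opp.
    apply plus_comm.
Qed.

(** The invariant distance D = |x - x'| / (1 - kappa) is the fixed point of
    D -> |x - x'| + kappa D; one more step through the second component gives
    kappa D. *)
Lemma perron_iter_lipschitz (kappa : R) (j : nat) (x x' : U) :
  delta / (beta - sigma) <= kappa -> delta / (sigma - alpha) <= kappa -> kappa < 1 ->
  norm (minus (snd (perron_iter alpha E1 E2 N1 N2 (S j) x 0))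
              (snd (perron_iter alpha E1 E2 N1 N2 (S j) x' 0)))
    <= kappa / (1 - kappa) * norm (minus x x').
Proof.
  intros hk1 hk2 hk.
  set (L := norm (minus x x')). assert (hL : 0 <= L) by apply norm_ge_0.
  set (D := L / (1 - kappa)).
  assert (hk0 : 0 <= kappa).
  { apply Rle_trans with (2 := hk1). apply Rdiv_le_0_compat; lra. }
  assert (hD : 0 <= D) by (apply Rdiv_le_0_compat; lra).
  assert (hfix : L + kappa * D = D) by (unfold D; field; lra).
  assert (hkD : kappa * D <= D).
  { rewrite <- (Rmult_1_l D) at 2. apply Rmult_le_compat_r; lra. }
  assert (hq1 : delta * D / (sigma - alpha) <= kappa * D).
  { replace (delta * D / (sigma - alpha)) with (delta / (sigma - alpha) * D) by (field; lra).
    apply Rmult_le_compat_r; lra. }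
  assert (hq2 : delta * D / (beta - sigma) <= kappa * D).
  { replace (delta * D / (beta - sigma)) with (delta / (beta - sigma) * D) by (field; lra).
    apply Rmult_le_compat_r; lra. }
  assert (hiter : forall i s, 0 <= s ->
    max_norm (minus (perron_iter alpha E1 E2 N1 N2 i x s) (perron_iter alpha E1 E2 N1 N2 i x' s))
      <= D * exp (sigma * s)).
  { induction i as [|i IH]; intros s hs; pose proof (exp_pos (sigma * s)) as hp.
    - apply max_norm_le; simpl.
      + refine (Rle_trans _ _ _
          (Req_le _ _ (f_equal norm (eq_sym (scal_minus_distr_l (V := U) (exp (alpha * s)) x x')))) _).
        eapply Rle_trans; [apply (@norm_scal R_AbsRing)|].
        change (Rabs (exp (alpha * s)) * L <= D * exp (sigma * s)).
        rewrite Rabs_right by (apply Rle_ge, Rlt_le, exp_pos).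
        rewrite Rmult_comm. apply Rmult_le_compat; [lra|apply Rlt_le, exp_pos| |].
        * assert (0 <= kappa * D) by (apply Rmult_le_pos; lra). lra.
        * apply exp_monotone, Rmult_le_compat_r; lra.
      + refine (Rle_trans _ _ _ (Req_le _ _ (f_equal norm (minus_eq_zero _))) _).
        refine (Rle_trans _ _ _ (Req_le _ _ norm_zero) _). apply Rmult_le_pos; lra.
    - destruct (perron_map_diff _ _ x x' D (perron_iter_admissible i x)
                  (perron_iter_admissible i x') IH s hs) as [b1 b2].
      apply max_norm_le.
      + refine (Rle_trans _ _ _ b1 _). apply Rmult_le_compat_r; [lra|]. fold L. lra.
      + refine (Rle_trans _ _ _ b2 _). apply Rmult_le_compat_r; lra. }
  destruct (perron_map_diff _ _ x x' D (perron_iter_admissible j x)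
              (perron_iter_admissible j x') (hiter j) 0 (Rle_refl 0)) as [_ b].
  refine (Rle_trans _ _ _ b _). rewrite Rmult_0_r, exp_0, Rmult_1_r.
  replace (kappa / (1 - kappa) * L) with (kappa * D) by (unfold D; field; lra).
  exact hq2.
Qed.
End Perron.

(** * Perturbations and time reversal *)

Lemma lipschitz_comp_continuous {U V W : NormedModule R_AbsRing} (delta : R)
    (hdelta : 0 <= delta) (F : U * V -> W)
    (hF : forall w w', norm (minus (F w) (F w')) <= delta * max_norm (minus w w'))
    (phi : R -> U * V) (hphi : pair_continuous phi) (t : R) :
  continuous (fun s => F (phi s)) t.
Proof.
  refine (proj2 (continuous_norm_iff (V := W) _ _) _); intros eps heps.
  assert (he : 0 < eps / (delta + 1)) by (apply Rdiv_lt_0_compat; lra).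
  destruct hphi as [h1 h2].
  destruct (proj1 (continuous_norm_iff _ _) (h1 t) _ he) as [d1 [hd1 Hd1]].
  destruct (proj1 (continuous_norm_iff _ _) (h2 t) _ he) as [d2 [hd2 Hd2]].
  exists (Rmin d1 d2); split; [apply Rmin_glb_lt; assumption|].
  intros s hs.
  specialize (Hd1 s (Rlt_le_trans _ _ _ hs (Rmin_l _ _))).
  specialize (Hd2 s (Rlt_le_trans _ _ _ hs (Rmin_r _ _))).
  eapply Rle_lt_trans; [apply hF|].
  apply Rle_lt_trans with (delta * (eps / (delta + 1))).
  - apply Rmult_le_compat_l; [exact hdelta|].
    apply max_norm_le; apply Rlt_le; assumption.
  - replace eps with ((delta + 1) * (eps / (delta + 1))) at 2 by (field; lra).
    apply Rmult_lt_compat_r; lra.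
Qed.

(** The common translation by zeta cancels in differences, so the Lipschitz
    constant of F is inherited. *)
Lemma increment_perturbation {U V W : NormedModule R_AbsRing} (delta : R)
    (hdelta : 0 <= delta) (F : U * V -> W)
    (hF : forall w w', norm (minus (F w) (F w')) <= delta * max_norm (minus w w'))
    (zeta : R -> U * V) (hzeta : pair_continuous zeta) :
  perturbation delta (fun s w => minus (F (plus w (zeta s))) (F (zeta s))).
Proof.
  split.
  - intros s w w'.
    refine (Rle_trans _ _ _ (Req_le _ _ (f_equal norm (minus_plus_r _ _ _))) _).
    refine (Rle_trans _ _ _ (hF _ _) _).
    refine (Req_le _ _ (f_equal (fun w => delta * max_norm w) _)).
    apply (minus_plus_r (G := prod_AbelianGroup U V)).
  - intros s.
    refine (eq_trans (f_equal (fun w => minus (F w) (F (zeta s))) _) (minus_eq_zero _)).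
    apply (plus_zero_l (G := prod_AbelianGroup U V)).
  - intros phi hphi t. apply (continuous_minus (V := W)).
    + apply (lipschitz_comp_continuous delta hdelta F hF (fun s => plus (phi s) (zeta s))).
      destruct hphi as [p1 p2], hzeta as [z1 z2].
      split; intros s; simpl.
      * apply (continuous_plus (V := U)); [apply p1|apply z1].
      * apply (continuous_plus (V := V)); [apply p2|apply z2].
    + apply (lipschitz_comp_continuous delta hdelta F hF zeta hzeta).
Qed.

Lemma pair_continuous_reverse {U V : NormedModule R_AbsRing} (phi : R -> U * V) :
  pair_continuous phi -> pair_continuous (fun s => (snd (phi (- s)), fst (phi (- s)))).
Proof.
  assert (hopp : forall t : R, continuous (fun s : R => - s) t).
  { intros t. apply (continuous_opp (fun s : R => s)), continuous_id. }
  intros [h1 h2]; split; intros t; simpl.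
  - apply (continuous_comp (fun s : R => - s) (fun s => snd (phi s))); auto.
  - apply (continuous_comp (fun s : R => - s) (fun s => fst (phi s))); auto.
Qed.

(** The sign comes from ds -> -ds under time reversal, and the swap from the
    exchange of the two factors. *)
Lemma reverse_perturbation {U V W : NormedModule R_AbsRing} (delta : R)
    (N : R -> U * V -> W) (hN : perturbation delta N) :
  perturbation delta (fun s (w : V * U) => opp (N (- s) (snd w, fst w))).
Proof.
  split.
  - intros s w w'.
    refine (Rle_trans _ _ _ (Req_le _ _ (f_equal norm (minus_opp_opp _ _))) _).
    refine (Rle_trans _ _ _ (Req_le _ _ (norm_opp _)) _).
    refine (Rle_trans _ _ _ (perturbation_lipschitz _ _ hN _ _ _) _).
    apply Req_le, f_equal, (max_norm_swap (minus w w')).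
  - intros s.
    refine (eq_trans (f_equal opp (perturbation_zero _ _ hN (- s))) opp_zero).
  - intros phi hphi t.
    apply (continuous_opp (fun s => N (- s) (snd (phi s), fst (phi s)))).
    apply (continuous_ext (fun s => N (- s) (snd (phi (- - s)), fst (phi (- - s))))).
    { intros s; simpl. rewrite Ropp_involutive. reflexivity. }
    apply (continuous_comp (fun s : R => - s) (fun s => N s (snd (phi (- s)), fst (phi (- s))))).
    + apply (continuous_opp (fun s : R => s)), continuous_id.
    + apply (perturbation_continuous _ _ hN), pair_continuous_reverse, hphi.
Qed.

Lemma reverse_regular_kernel {X : NormedModule R_AbsRing} (E : R -> X -> X) :
  regular_kernel E -> regular_kernel (fun t => E (- t)).
Proof.
  intros hE; split.
  - intros t; apply (kernel_minus E hE).
  - intros t; apply (kernel_scal E hE).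
  - intros r. destruct (kernel_bound E hE r) as [K [hK HK]].
    exists K; split; [exact hK|]. intros s t x hs ht.
    destruct (HK (- s) (- t) x) as [b1 b2]; [rewrite Rabs_Ropp; assumption..|].
    split; [exact b1|].
    replace (- t - - s) with (- (t - s)) in b2 by ring.
    rewrite Rabs_Ropp in b2. exact b2.
Qed.

Lemma flow_pair_continuous {X Y : CompleteNormedModule R_AbsRing}
    (A : X -> X) (B : Y -> Y) (F : X * Y -> X) (G : X * Y -> Y)
    (z : X * Y -> R -> X * Y) (hz : is_solution_flow A B F G z) (z0 : X * Y) :
  pair_continuous (z z0).
Proof.
  destruct (hz z0) as [_ hd].
  split; intros t; destruct (hd t) as [d1 d2].
  - apply (ex_derive_continuous (fun s => fst (z z0 s))). eexists; exact d1.
  - apply (ex_derive_continuous (fun s => snd (z z0 s))). eexists; exact d2.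
Qed.

Lemma kernel_opp {X : NormedModule R_AbsRing} (E : R -> X -> X) (hE : regular_kernel E)
    (t : R) (x : X) : E t (opp x) = opp (E t x).
Proof.
  refine (eq_trans (f_equal (E t) (eq_sym (scal_opp_one x))) _).
  refine (eq_trans (kernel_scal E hE t _ x) (scal_opp_one _)).
Qed.

Lemma is_RInt_gen_reverse {V : NormedModule R_AbsRing} (k : R -> V) (t : R) (l : V) :
  is_RInt_gen (fun s => opp (k (- s))) (at_point t) (Rbar_locally p_infty) l ->
  is_RInt_gen k (Rbar_locally m_infty) (at_point (- t)) (opp l).
Proof.
  intros H. apply is_RInt_gen_swap; try typeclasses eauto.
  intros P HP. destruct (H P HP) as [Q S hQ [M hS] HQS].
  apply (Filter_prod _ _ _ (fun a => a = - t) (fun b => b < - M)).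
  - reflexivity.
  - exists (- M); auto.
  - intros a b -> hb. simpl.
    destruct (HQS t (- b) hQ (hS (- b) ltac:(lra))) as [y [hy hPy]].
    exists y; split; [|exact hPy]. simpl in hy.
    apply (is_RInt_ext (fun s => opp (opp (k (- - s))))).
    { intros s _. rewrite Ropp_involutive. exact (opp_opp (k s)). }
    apply (is_RInt_comp_opp (fun s => opp (k (- s)))).
    rewrite Ropp_involutive. exact hy.
Qed.

(** Substituting s -> -s turns the integral over (-oo, -t] into one over
    [t, oo) and the integral over [-t, 0] into one over [0, t].  Existence of the
    integrals is needed, since a sign cannot be moved through a meaningless one;
    this is what admissibility of phi provides. *)
Lemma U_map_reverse {X Y : CompleteNormedModule R_AbsRing}
    (A : X -> X) (B : Y -> Y) (F : X * Y -> X) (G : X * Y -> Y)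
    (z : X * Y -> R -> X * Y) (z0 : X * Y) (alpha beta delta sigma : R)
    (hA : regular_kernel (op_exp A)) (hB : regular_kernel (op_exp B))
    (hdelta : 0 <= delta) (hsigma : sigma < beta)
    (E1 := fun t => op_exp B (- t)) (E2 := fun t => op_exp A (- t))
    (N1 := fun s (w : Y * X) =>
       opp (minus (G (plus (snd w, fst w) (z z0 (- s)))) (G (z z0 (- s)))))
    (N2 := fun s (w : Y * X) =>
       opp (minus (F (plus (snd w, fst w) (z z0 (- s)))) (F (z z0 (- s)))))
    (hE : dichotomy alpha beta E1 E2)
    (hN1 : perturbation delta N1) (hN2 : perturbation delta N2)
    (psi : R -> X * Y) (phi : R -> Y * X) (hphi : admissible sigma phi)
    (hpsi : forall s, psi (- s) = (snd (phi s), fst (phi s))) (y : Y) (t : R) :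
  U_map A B F G z z0 psi y (- t)
    = (snd (perron_map E1 E2 N1 N2 phi y t), fst (perron_map E1 E2 N1 N2 phi y t)).
Proof.
  destruct hE as [hE1 hE2 ha hb]. destruct hphi as [hc [C hC]].
  pose proof (perturbation_continuous _ _ hN1 phi hc) as hc1.
  pose proof (perturbation_continuous _ _ hN2 phi hc) as hc2.
  pose proof (perturbation_decay delta sigma C hdelta N2 hN2 phi hC) as hd2.
  unfold U_map, perron_map; simpl. f_equal.
  - apply is_RInt_gen_unique. refine (is_RInt_gen_reverse (V := X) _ _ _ _).
    eapply is_RInt_gen_ext.
    2: { exact (backward_integral_correct E2 hE2 beta sigma (delta * C) hsigma hb
                  (fun s => N2 s (phi s)) hc2 hd2 t). }
    apply filter_forall. intros ab s _.
    unfold E2, N2. refine (eq_trans (kernel_opp _ hA _ _) _).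
    rewrite hpsi. do 2 f_equal. ring.
  - pose proof (RInt_correct _ _ _
      (kernel_ex_RInt E1 hE1 (fun s => N1 s (phi s)) hc1 t 0 t)) as i.
    set (l := RInt (fun s => E1 (t - s) (N1 s (phi s))) 0 t) in *.
    rewrite (is_RInt_unique _ _ _ (opp l)).
    { unfold minus. exact (f_equal (plus _) (opp_opp l)). }
    refine (is_RInt_swap (V := Y) _ _ _ _ _).
    apply (is_RInt_ext (V := Y) (fun s => opp (E1 (t - - s) (N1 (- s) (phi (- s)))))).
    2: { apply (is_RInt_comp_opp (V := Y) (fun s => E1 (t - s) (N1 s (phi s)))).
         rewrite Ropp_0, Ropp_involutive. exact i. }
    intros s _. unfold E1, N1.
    refine (eq_trans (f_equal opp (kernel_opp _ hB _ _)) (eq_trans (opp_opp _) _)).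
    rewrite Ropp_involutive, <- hpsi, Ropp_involutive. f_equal. ring.
Qed.

(** Here the iterates are literally those of the abstract map. *)
Lemma Phi_lipschitz {X Y : CompleteNormedModule R_AbsRing}
    (A : X -> X) (B : Y -> Y) (F : X * Y -> X) (G : X * Y -> Y)
    (z : X * Y -> R -> X * Y) (alpha beta delta sigma kappa : R)
    (hdelta : 0 <= delta) (hsigma : alpha < sigma < beta)
    (hE : dichotomy alpha beta (op_exp A) (op_exp B))
    (hF : forall w w', norm (minus (F w) (F w')) <= delta * max_norm (minus w w'))
    (hG : forall w w', norm (minus (G w) (G w')) <= delta * max_norm (minus w w'))
    (hz : is_solution_flow A B F G z)
    (hk1 : delta / (beta - sigma) <= kappa) (hk2 : delta / (sigma - alpha) <= kappa)
    (hk : kappa < 1) (j : nat) (y1 : Y) (x x' : X) :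
  norm (minus (Phi alpha A B F G z (S j) y1 x) (Phi alpha A B F G z (S j) y1 x'))
    <= kappa / (1 - kappa) * norm (minus x x').
Proof.
  set (N1 := fun s (w : X * Y) => minus (F (plus w (z (zero, y1) s))) (F (z (zero, y1) s))).
  set (N2 := fun s (w : X * Y) => minus (G (plus w (z (zero, y1) s))) (G (z (zero, y1) s))).
  pose proof (flow_pair_continuous A B F G z hz (zero, y1)) as hzc.
  assert (hN1 : perturbation delta N1) by exact (increment_perturbation delta hdelta F hF _ hzc).
  assert (hN2 : perturbation delta N2) by exact (increment_perturbation delta hdelta G hG _ hzc).
  assert (hiter : forall i x, phi_iter alpha A B F G z y1 i x
    = perron_iter alpha (op_exp A) (op_exp B) N1 N2 i x).
  { induction i as [|i IH]; intros u; [reflexivity|]. simpl. rewrite IH. reflexivity. }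
  unfold Phi. rewrite !hiter.
  refine (Rle_trans _ _ _ (Req_le _ _ (f_equal norm _))
    (perron_iter_lipschitz alpha beta delta sigma _ _ N1 N2 hdelta hsigma hE hN1 hN2
       kappa j x x' hk1 hk2 hk)).
  rewrite !(plus_comm y1). exact (minus_plus_r (G := Y) _ _ _).
Qed.

(** The reversed system has rates (-beta, -alpha) and weight -sigma; the two
    denominators beta - sigma and sigma - alpha merely trade places. *)
Lemma Psi_lipschitz {X Y : CompleteNormedModule R_AbsRing}
    (A : X -> X) (B : Y -> Y) (F : X * Y -> X) (G : X * Y -> Y)
    (z : X * Y -> R -> X * Y) (alpha beta delta sigma kappa : R)
    (hdelta : 0 <= delta) (hsigma : alpha < sigma < beta)
    (hE : dichotomy alpha beta (op_exp A) (op_exp B))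
    (hF : forall w w', norm (minus (F w) (F w')) <= delta * max_norm (minus w w'))
    (hG : forall w w', norm (minus (G w) (G w')) <= delta * max_norm (minus w w'))
    (hz : is_solution_flow A B F G z)
    (hk1 : delta / (beta - sigma) <= kappa) (hk2 : delta / (sigma - alpha) <= kappa)
    (hk : kappa < 1) (j : nat) (x1 : X) (y y' : Y) :
  norm (minus (Psi beta A B F G z (S j) x1 y) (Psi beta A B F G z (S j) x1 y'))
    <= kappa / (1 - kappa) * norm (minus y y').
Proof.
  destruct hE as [hA hB ha hb].
  set (z0 := (x1, zero) : X * Y).
  set (E1 := fun t => op_exp B (- t)).
  set (E2 := fun t => op_exp A (- t)).
  set (N1 := fun s (w : Y * X) =>
       opp (minus (G (plus (snd w, fst w) (z z0 (- s)))) (G (z z0 (- s))))).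
  set (N2 := fun s (w : Y * X) =>
       opp (minus (F (plus (snd w, fst w) (z z0 (- s)))) (F (z z0 (- s))))).
  pose proof (flow_pair_continuous A B F G z hz z0) as hzc.
  assert (hN1 : perturbation delta N1).
  { exact (reverse_perturbation delta (fun s w => minus (G (plus w (z z0 s))) (G (z z0 s)))
      (increment_perturbation delta hdelta G hG _ hzc)). }
  assert (hN2 : perturbation delta N2).
  { exact (reverse_perturbation delta (fun s w => minus (F (plus w (z z0 s))) (F (z z0 s)))
      (increment_perturbation delta hdelta F hF _ hzc)). }
  assert (hE' : dichotomy (- beta) (- alpha) E1 E2).
  { split.
    - apply reverse_regular_kernel, hB.
    - apply reverse_regular_kernel, hA.
    - exact hb.
    - intros t x ht. unfold E2. rewrite !Ropp_involutive. apply ha, ht. }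
  assert (hsigma' : - beta < - sigma < - alpha) by lra.
  assert (hiter : forall i y t, psi_iter beta A B F G z x1 i y (- t)
    = (snd (perron_iter (- beta) E1 E2 N1 N2 i y t), fst (perron_iter (- beta) E1 E2 N1 N2 i y t))).
  { induction i as [|i IH]; intros u t.
    - simpl. do 3 f_equal. ring.
    - exact (U_map_reverse A B F G z z0 (- beta) (- alpha) delta (- sigma) hA hB hdelta
               (proj2 hsigma') hE' hN1 hN2 _ _
               (perron_iter_admissible (- beta) (- alpha) delta (- sigma) E1 E2 N1 N2
                  hdelta hsigma' hE' hN1 hN2 i u) (IH u) u t). }
  assert (hiter0 : forall i u, fst (psi_iter beta A B F G z x1 i u 0)
    = snd (perron_iter (- beta) E1 E2 N1 N2 i u 0)).
  { intros i u. rewrite <- Ropp_0 at 1. rewrite hiter. reflexivity. }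
  unfold Psi. rewrite !hiter0.
  refine (Rle_trans _ _ _ (Req_le _ _ (f_equal norm _))
    (perron_iter_lipschitz (- beta) (- alpha) delta (- sigma) _ _ N1 N2 hdelta hsigma' hE'
       hN1 hN2 kappa j y y' _ _ hk)).
  - rewrite !(plus_comm x1). exact (minus_plus_r (G := X) _ _ _).
  - replace (- alpha - - sigma) with (sigma - alpha) by ring. exact hk2.
  - replace (- sigma - - beta) with (beta - sigma) by ring. exact hk1.
Qed.

Theorem proposition4p4
  (X Y : CompleteNormedModule R_AbsRing)
  (A : X -> X) (B : Y -> Y) (F : X * Y -> X) (G : X * Y -> Y)
  (alpha beta delta : R)
  (hA : is_linear A) (hB : is_linear B)
  (hdelta : 0 <= delta)
  (hexpA : forall t : R, 0 <= t ->
     Rbar_le (op_norm (op_exp A t)) (Finite (exp (alpha * t))))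
  (hexpB : forall t : R, 0 <= t ->
     Rbar_le (op_norm (op_exp B (- t))) (Finite (exp (- beta * t))))
  (hLip : lipschitz_with (fun w : X * Y => (F w, G w)) delta)
  (hF0 : F (zero, zero) = zero) (hG0 : G (zero, zero) = zero)
  (hgap : 2 * delta < beta - alpha)
  (z : X * Y -> R -> X * Y)
  (hz : is_solution_flow A B F G z)
  (x1 : X) (y1 : Y) (j1 j2 : nat)
  (hj1 : (1 <= j1)%nat) (hj2 : (1 <= j2)%nat)
  (hgap4 : 4 * delta < beta - alpha) :
  contraction (Sigma alpha beta A B F G z j1 j2 x1 y1) /\
  forall sigma : R, alpha + delta < sigma < beta - delta ->
    let kappa := Rmax (delta / (beta - sigma)) (delta / (sigma - alpha)) in
    Rbar_le (Lip (Sigma alpha beta A B F G z j1 j2 x1 y1))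
            (Finite (kappa / (1 - kappa))).
Proof.
  assert (hF : forall w w', norm (minus (F w) (F w')) <= delta * max_norm (minus w w')).
  { intros w w'. refine (Rle_trans _ _ _ _ (proj2 hLip w w')). apply Rmax_l. }
  assert (hG : forall w w', norm (minus (G w) (G w')) <= delta * max_norm (minus w w')).
  { intros w w'. refine (Rle_trans _ _ _ _ (proj2 hLip w w')). apply Rmax_r. }
  pose proof (op_exp_regular A hA) as hEA.
  pose proof (op_exp_regular B hB) as hEB.
  assert (hE : dichotomy alpha beta (op_exp A) (op_exp B)).
  { split; [exact hEA|exact hEB| |]; intros t x ht; revert x; apply op_norm_le_apply; auto.
    - apply (kernel_scal _ hEA).
    - apply (kernel_scal _ hEB). }
  assert (main : forall sigma, alpha + delta < sigma < beta - delta ->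
    let kappa := Rmax (delta / (beta - sigma)) (delta / (sigma - alpha)) in
    lipschitz_with (Sigma alpha beta A B F G z j1 j2 x1 y1) (kappa / (1 - kappa))).
  { intros sigma hs kappa.
    assert (hk1 : delta / (beta - sigma) <= kappa) by apply Rmax_l.
    assert (hk2 : delta / (sigma - alpha) <= kappa) by apply Rmax_r.
    assert (hk : kappa < 1).
    { apply Rmax_lub_lt.
      - apply Rmult_lt_reg_r with (beta - sigma); [lra|].
        unfold Rdiv; rewrite Rmult_assoc, Rinv_l; lra.
      - apply Rmult_lt_reg_r with (sigma - alpha); [lra|].
        unfold Rdiv; rewrite Rmult_assoc, Rinv_l; lra. }
    assert (hk0 : 0 <= kappa).
    { apply Rle_trans with (2 := hk1). apply Rdiv_le_0_compat; lra. }
    assert (hq : 0 <= kappa / (1 - kappa)) by (apply Rdiv_le_0_compat; lra).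
    assert (hsigma : alpha < sigma < beta) by lra.
    split; [exact hq|]. intros w w'.
    destruct j1 as [|i1]; [inversion hj1|]. destruct j2 as [|i2]; [inversion hj2|].
    apply max_norm_le.
    - eapply Rle_trans; [apply (Psi_lipschitz A B F G z alpha beta delta sigma kappa); assumption|].
      apply Rmult_le_compat_l; [exact hq|apply Rmax_r].
    - eapply Rle_trans; [apply (Phi_lipschitz A B F G z alpha beta delta sigma kappa); assumption|].
      apply Rmult_le_compat_l; [exact hq|apply Rmax_l]. }
  split.
  - set (sigma := (alpha + beta) / 2).
    exists (Rmax (delta / (beta - sigma)) (delta / (sigma - alpha))
            / (1 - Rmax (delta / (beta - sigma)) (delta / (sigma - alpha)))).
    split; [|apply main; unfold sigma; lra].
    replace (beta - sigma) with (sigma - alpha) by (unfold sigma; field).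
    rewrite Rmax_left by apply Rle_refl.
    set (r := sigma - alpha). assert (hr : 2 * delta < r) by (unfold r, sigma; lra).
    replace (delta / r / (1 - delta / r)) with (delta / (r - delta)) by (field; lra).
    apply Rmult_lt_reg_r with (r - delta); [lra|].
    unfold Rdiv; rewrite Rmult_assoc, Rinv_l; lra.
  - intros sigma hs kappa.
    apply (proj1 (Glb_Rbar_correct (lipschitz_with (Sigma alpha beta A B F G z j1 j2 x1 y1)))).
    apply main; exact hs.
Qed.
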